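(* Let $p\geq 7$ be a prime number. Consider the left braces, up to isomorphism, with additive group $\mathbf{Z}_p\times\mathbf{Z}_{12}$ and multiplicative group a semidirect product $\mathbf{Z}_p\rtimes\mathbf{Z}_{12}$. 1) If $p\equiv 11\pmod{12}$ there are 2 such braces. One of them is a direct product and the second one has a kernel of order 6. 2) If $p\equiv 5\pmod{12}$ there are 3 such braces. One of them is a direct product, one has a kernel of order 6, and the third one has a kernel of order 3. 3) If $p\equiv 7\pmod{12}$ there are 4 such braces. One of them is a direct product, one has a kernel of order 6, and the other two have kernels of orders 2 and 4, respectively. 4) If $p\equiv 1\pmod{12}$ there are 6 such braces. One of them is a direct product and the other five have kernels of orders 6, 4, 3, 2, 1, respectively.
   Context: A left brace is a set $B$ with operations $+,\cdot$ such that $(B,+)$ is an abelian group (additive group), $(B,\cdot)$ is a group (multiplicative group), and $a(b+c)=ab-a+ac$ for all $a,b,c\in B$. Isomorphisms are bijections preserving both operations. $\mathbf{Z}_m=\mathbf{Z}/m\mathbf{Z}$. Given a left brace $B'$ of size 12 with multiplicative group $F$ and a group morphism $\tau:F\to\mathrm{Aut}(\mathbf{Z}_p)\simeq\mathbf{Z}_p^*$, the semidirect product of the trivial brace $\mathbf{Z}_p$ (with $a\cdot b=a+b$) and $B'$ via $\tau$ is $\mathbf{Z}_p\times B'$ with componentwise addition and $(a,b)\cdot(a',b')=(a+\tau(b)a',bb')$; it is the direct product of braces when $\tau$ is trivial. For $p\geq 7$ every left brace of size $12p$ is isomorphic to one of this form. The kernel of the brace means $\ker\tau\subseteq F$. ''Multiplicative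 group $\mathbf{Z}_p\rtimes F$'' means isomorphic to $\mathbf{Z}_p\rtimes_\tau F$ for some $\tau$, possibly trivial. *)

(* Defs.v *)
From HB Require Import structures.
From mathcomp Require Import all_boot all_order all_algebra all_fingroup.

Set Implicit Arguments.
Unset Strict Implicit.
Unset Printing Implicit Defensive.

Import GRing.Theory.
Local Open Scope ring_scope.

(* The multiplicative structure gets its own operations because the group     *)
(* operation of MathComp on a finite zmodType already denotes its addition;   *)
(* the alias mulgroup below carries (B, bmul) as a finGroupType.              *)
HB.mixin Record isLeftBrace B of GRing.Zmodule B := {
  bmul : B -> B -> B;
  bone : B;
  binv : B -> B;
  bmulA : associative bmul;
  bmul1b : left_id bone bmul;
  bmulVb : left_inverse bone binv bmul;
  bmulDr : forall a b c : B, bmul a (b + c) = bmul a b - a + bmul a c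
}.

#[short(type="leftBraceType")]
HB.structure Definition LeftBrace := { B of isLeftBrace B & GRing.Zmodule B }.

#[short(type="finLeftBraceType")]
HB.structure Definition FinLeftBrace :=
  { B of isLeftBrace B & FinRing.Zmodule B }.

Definition brace_iso (A B : leftBraceType) : Prop :=
  exists f : A -> B, [/\ bijective f, {morph f : x y / x + y}
                       & {morph f : x y / bmul x y}].

Definition mulgroup (B : Type) : Type := B.

Section MulGroup.
Variable B : finLeftBraceType.
HB.instance Definition _ := Finite.copy (mulgroup B) B.
HB.instance Definition _ :=
  Finite_isGroup.Build (mulgroup B) (@bmulA B) (@bmul1b B) (@bmulVb B).
End MulGroup.

Definition trivial_brace (G : Type) : Type := G.

Section TrivialBrace.
Variable G : finZmodType.
HB.instance Definition _ := FinRing.Zmodule.copy (trivial_brace G) G.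

Fact trivial_braceD (a b c : trivial_brace G) :
  a + (b + c) = (a + b) - a + (a + c).
Proof. by rewrite [a + b]addrC addrK addrCA. Qed.

HB.instance Definition _ := isLeftBrace.Build (trivial_brace G)
  (@addrA G) (@add0r G) (@addNr G) trivial_braceD.
End TrivialBrace.

Section DirectProduct.
Variables B1 B2 : finLeftBraceType.
Implicit Types x y z : B1 * B2.

Definition dprod_mul x y : B1 * B2 := (bmul x.1 y.1, bmul x.2 y.2).
Definition dprod_one : B1 * B2 := (bone, bone).
Definition dprod_inv x : B1 * B2 := (binv x.1, binv x.2).

Fact dprod_mulA : associative dprod_mul.
Proof. by move=> x y z; rewrite /dprod_mul !bmulA. Qed.

Fact dprod_mul1 : left_id dprod_one dprod_mul.
Proof. by case=> a b; rewrite /dprod_mul !bmul1b. Qed.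

Fact dprod_mulV : left_inverse dprod_one dprod_inv dprod_mul.
Proof. by case=> a b; rewrite /dprod_mul !bmulVb. Qed.

Fact dprod_mulDr x y z :
  dprod_mul x (y + z) = dprod_mul x y - x + dprod_mul x z.
Proof. by case: x y z => [a b] [c d] [e f]; rewrite /dprod_mul !bmulDr. Qed.

HB.instance Definition _ := isLeftBrace.Build (B1 * B2)%type
  dprod_mulA dprod_mul1 dprod_mulV dprod_mulDr.
End DirectProduct.

(* A morphism F -> Aut(Z_p) is given as a morphism tau into {unit 'Z_p}, the  *)
(* automorphism tau(b) being multiplication by the unit tau b.                *)
Definition semidirect_brace (p : nat) (B : finLeftBraceType)
  (tau : {morphism [set: mulgroup B] >-> {unit 'Z_p}}) : Type :=
  ('Z_p * B)%type.

Section SemidirectProduct.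
Variables (p : nat) (B : finLeftBraceType).
Variable tau : {morphism [set: mulgroup B] >-> {unit 'Z_p}}.
Implicit Types x y z : 'Z_p * B.

Definition sd_mul x y : 'Z_p * B := (x.1 + val (tau x.2) * y.1, bmul x.2 y.2).
Definition sd_one : 'Z_p * B := (0, bone).
Definition sd_inv x : 'Z_p * B :=
  (- (val (tau (binv x.2)) * x.1), binv x.2).

Fact sd_tauM (a b : B) : val (tau (bmul a b)) = val (tau a) * val (tau b).
Proof. by rewrite (morphM tau) ?inE. Qed.

Fact sd_mulA : associative sd_mul.
Proof.
by move=> x y z; rewrite /sd_mul /= sd_tauM mulrDr mulrA addrA bmulA.
Qed.

Fact sd_mul1 : left_id sd_one sd_mul.
Proof.
case=> a b; rewrite /sd_mul /= add0r bmul1b.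
by rewrite (_ : tau bone = 1%g) ?mul1r // (morph1 tau).
Qed.

Fact sd_mulV : left_inverse sd_one sd_inv sd_mul.
Proof. by case=> a b; rewrite /sd_mul /= addNr bmulVb. Qed.

Fact sd_mulDr x y z : sd_mul x (y + z) = sd_mul x y - x + sd_mul x z.
Proof.
case: x y z => [a b] [c d] [e f]; rewrite /sd_mul /= bmulDr; congr pair.
by rewrite /= mulrDr [a + _ * c]addrC addrK addrCA.
Qed.

HB.instance Definition _ := Finite.copy (semidirect_brace tau) ('Z_p * B)%type.
HB.instance Definition _ :=
  GRing.Zmodule.copy (semidirect_brace tau) ('Z_p * B)%type.
HB.instance Definition _ := isLeftBrace.Build (semidirect_brace tau)
  sd_mulA sd_mul1 sd_mulV sd_mulDr.
End SemidirectProduct.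

Definition has_additive_group (B : finLeftBraceType) (A : zmodType) : Prop :=
  exists f : B -> A, bijective f /\ {morph f : x y / x + y}.

Definition has_semidirect_mul_group (p m : nat) (B : finLeftBraceType) : Prop :=
  exists to : groupAction [set: 'Z_m] [set: 'Z_p],
    [set: mulgroup B] \isog [set: sdprod_by to].

Definition brace_Zp_Z12 (p : nat) (B : finLeftBraceType) : Prop :=
  has_additive_group B ('Z_p * 'Z_12)%type /\ has_semidirect_mul_group p 12 B.

Definition iso_classes (P : finLeftBraceType -> Prop) (n : nat)
    (Bs : 'I_n -> finLeftBraceType) : Prop :=
  [/\ forall i, P (Bs i),
      forall i j, brace_iso (Bs i) (Bs j) -> i = j
    & forall B, P B -> exists i, brace_iso B (Bs i)].

Definition is_direct_product (p : nat) (B : finLeftBraceType) : Prop :=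
  exists B' : finLeftBraceType,
    #|B'| = 12%N /\ brace_iso B (trivial_brace 'Z_p * B')%type.

(* For p >= 5 prime the order of ker tau does not depend on the presentation: *)
(* p * #|ker tau| is the order of the kernel of the action x |-> ax - a of    *)
(* the multiplicative group on the Sylow p-subgroup of the additive group.    *)
Definition has_kernel_of_order (p : nat) (B : finLeftBraceType) (k : nat) :
    Prop :=
  exists (B' : finLeftBraceType)
         (tau : {morphism [set: mulgroup B'] >-> {unit 'Z_p}}),
    [/\ #|B'| = 12%N, brace_iso B (semidirect_brace tau) & #|('ker tau)%g| = k].

(* Main.v *)
Require Import Defs.
From mathcomp Require Import all_boot all_order all_algebra all_fingroup.
From mathcomp Require Import cyclic.

(** Let B be a brace with additive group Z_p x Z_12.  For each a the map
    lambda_a : b |-> a b - a is an additive automorphism, and a |-> lambda_a is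
    multiplicative.  As p and 12 are coprime, an additive endomorphism of
    Z_p x Z_12 acts on each factor separately, so the brace is given by two
    characters alpha and beta of its multiplicative group, with values in the
    units of Z_p and of Z_12 ([lambda_characters]).

    The factor Z_p is a multiplicative subgroup of order p, and p is coprime to
    phi(p) = p - 1 and to phi(12) = 4; hence both characters are trivial on it
    and factor through Z_12, which thereby becomes a brace of its own.  If the
    multiplicative group is a semidirect product of Z_p by Z_12, its quotient by
    this subgroup is the cyclic group Z_12.  A brace with cyclic additive and
    multiplicative groups of order 12 is trivial ([beta_eq1_of_cyclic_mul]), so
    beta = 1 and B is the semidirect product of Z_p with the trivial brace Z_12
    via the character alpha : Z_12 -> Z_p^* ([brace_Zp_Z12_semidirect]).
    Conversely each such semidirect product is of the required type
    ([semidirect_mul_group]).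

    Two of these products are isomorphic exactly when their kernels have the
    same order.  An isomorphism multiplies the second coordinate by some d,
    which carries one kernel to the other ([semidirect_iso_eq_ker]).  In the
    other direction ([eq_ker_semidirect_iso]), characters with kernels of equal
    order have the same image, because Z_p^* is cyclic; they differ by a power
    map of that image, which lifts to an automorphism of Z_12 because an
    exponent coprime to the order of the image can be changed, modulo this
    order, into one coprime to 12.  A divisor k of 12 is the order of a kernel
    exactly when 12 / k divides p - 1 ([card_ker_character_dvd],
    [character_exists]), and the four residues of p modulo 12 give the four
    possible sets of such k. *)

Section Theory.
Set Implicit Arguments.
Unset Strict Implicit.

(** * Arithmetic *)

(** When d divides n this is the surjectivity of (Z/n)^* -> (Z/d)^*. *)
Lemma coprime_lift d k n : 0 < k -> 0 < n -> coprime d k ->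
  exists2 j, coprime n j & j = k %[mod d].
Proof.
(* A prime q of n divides k or the added term, but not both: the parts of n at
   and away from the primes of k separate the two cases. *)
move=> k_gt0 n_gt0 co_dk; exists (k + d * n`_(\pi(k)^'))%N; last first.
  by rewrite addnC mulnC modnMDl.
rewrite coprime_has_primes ?addn_gt0 ?k_gt0 //; apply/hasPn=> q /=.
rewrite !mem_primes addn_gt0 k_gt0 /= => /andP[q_pr q_dvd].
rewrite n_gt0 q_pr /=; apply/negP=> q_n; set t := (n`_ _)%N in q_dvd.
have q_t : (q %| t) = ~~ (q %| k).
  have <- : (q \in primes t) = (q %| t).
    by rewrite mem_primes q_pr part_gt0 andTb.
  rewrite primes_part mem_filter !inE /= !mem_primes q_pr k_gt0 n_gt0 q_n.
  by case: (q %| k).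
have [q_k|q_nk] := boolP (q %| k); last first.
  by case/negP: (q_nk); rewrite -(dvdn_addl k (n := d * t)) // dvdn_mull // q_t.
move: q_dvd; rewrite dvdn_addr // Euclid_dvdM // q_t q_k orbF => q_d.
have := coprime_dvdl q_d (coprime_dvdr q_k co_dk).
by rewrite /coprime gcdnn => /eqP q1; rewrite q1 in q_pr.
Qed.

Lemma totient_prime p : prime p -> totient p = p.-1.
Proof. by move=> p_pr; rewrite -[p in LHS]expn1 totient_pfactor // muln1. Qed.

Lemma coprime_totient_prime p : prime p -> coprime p (totient p).
Proof. by move=> p_pr; rewrite totient_prime // coprimenP ?prime_gt0. Qed.

Lemma coprime_prime_ge7 p n : prime p -> 7 <= p -> 0 < n < 7 -> coprime p n.
Proof.
move=> p_pr p_ge7 /andP[n_gt0 n_lt7].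
by rewrite prime_coprime // gtnNdvd // (leq_trans n_lt7).
Qed.

Lemma coprime_prime_12 p : prime p -> 7 <= p -> coprime p 12.
Proof. by move=> p_pr p_ge7; rewrite (coprimeMr p 2 6) !coprime_prime_ge7. Qed.

(** * Additive maps between cyclic groups *)

Section Additive.
Import GRing.Theory.
Local Open Scope ring_scope.

Lemma mulrn_coprime_eq0 (V : zmodType) (x : V) m n :
  coprime m n -> x *+ m = 0 -> x *+ n = 0 -> x = 0.
Proof.
case: m => [|m] co_mn xm xn.
  by move: co_mn xn; rewrite /coprime gcd0n => /eqP->.
case: (egcdnP n (ltn0Sn m)) => km kn def_km _; rewrite (eqnP co_mn) in def_km.
have := mulrnA x m.+1 km.
by rewrite mulnC def_km xm mul0rn mulrnDr mulnC mulrnA xn mul0rn add0r.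
Qed.

Lemma additive0 (U V : zmodType) (f : U -> V) :
  {morph f : x y / x + y} -> f 0 = 0.
Proof. by move=> fD; apply: (addrI (f 0)); rewrite -fD !addr0. Qed.

Lemma additive_mulrn (U V : zmodType) (f : U -> V) :
  {morph f : x y / x + y} -> forall x n, f (x *+ n) = f x *+ n.
Proof.
move=> fD x; elim=> [|k IHk]; first by rewrite !mulr0n additive0.
by rewrite !mulrSr fD IHk.
Qed.

Lemma mulrn_Zp n (x : 'Z_n) : (1 < n)%N -> x *+ n = 0.
Proof. by move=> n_gt1; rewrite -mulr_natr pchar_Zp // mulr0. Qed.

Lemma additive_ZpE n (V : zmodType) (f : 'Z_n -> V) :
  {morph f : x y / x + y} -> forall x, f x = f 1 *+ x.
Proof. by move=> fD x; rewrite -additive_mulrn // natr_Zp. Qed.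

Lemma additive_Zp_coprime m n (f : 'Z_m -> 'Z_n) :
    (1 < m)%N -> (1 < n)%N -> coprime m n ->
  {morph f : x y / x + y} -> forall x, f x = 0.
Proof.
move=> m_gt1 n_gt1 co_mn fD x.
apply: (mulrn_coprime_eq0 co_mn); last exact: mulrn_Zp.
by rewrite -additive_mulrn // mulrn_Zp // additive0.
Qed.

(** No nonzero additive map exists between Z_p and Z_m when p and m are
    coprime, so the matrix of an endomorphism of Z_p x Z_m is diagonal. *)
Lemma additive_prodE p m (f : 'Z_p * 'Z_m -> 'Z_p * 'Z_m) :
    (1 < p)%N -> (1 < m)%N -> coprime p m -> {morph f : x y / x + y} ->
  forall z, f z = ((f (1, 0)).1 * z.1, (f (0, 1)).2 * z.2).
Proof.
move=> p_gt1 m_gt1 co_pm fD [x u] /=.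
have -> : (x, u) = (x, 0) + (0, u) :> 'Z_p * 'Z_m.
  by congr pair; rewrite /= ?addr0 ?add0r.
have D1 : {morph (fun y : 'Z_p => f (y, 0)) : y z / y + z}.
  by move=> y z; rewrite -fD; congr (f (_, _)); rewrite /= addr0.
have D2 : {morph (fun y : 'Z_m => f (0, y)) : y z / y + z}.
  by move=> y z; rewrite -fD; congr (f (_, _)); rewrite /= addr0.
have f12 : (f (x, 0)).2 = 0.
  apply: (additive_Zp_coprime p_gt1 m_gt1 co_pm (f := fun y => (f (y, 0)).2)).
  by move=> y z; rewrite D1.
have f21 : (f (0, u)).1 = 0.
  rewrite coprime_sym in co_pm.
  apply: (additive_Zp_coprime m_gt1 p_gt1 co_pm (f := fun v => (f (0, v)).1)).
  by move=> y z; rewrite D2.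
have f11 : (f (x, 0)).1 = (f (1, 0)).1 * x.
  rewrite (@additive_ZpE _ _ (fun y => (f (y, 0)).1)) => [|y z].
    by rewrite -mulr_natr natr_Zp.
  by rewrite D1.
have f22 : (f (0, u)).2 = (f (0, 1)).2 * u.
  rewrite (@additive_ZpE _ _ (fun v => (f (0, v)).2)) => [|y z].
    by rewrite -mulr_natr natr_Zp.
  by rewrite D2.
by rewrite fD; congr pair; rewrite /= ?f12 ?f21 ?addr0 ?add0r.
Qed.

End Additive.

(** * Semidirect products with the trivial brace on a cyclic group *)

Section TrivialBraceCharacters.
Import GRing.Theory.
Local Open Scope group_scope.
Variables (p m : nat).
Local Notation C := (mulgroup (trivial_brace 'Z_m)).
Local Notation mor := {morphism [set: C] >-> {unit 'Z_p}}.
Implicit Type tau : mor.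
Local Notation c1 := (1%R : 'Z_m).

Lemma character_mulrn tau (u : 'Z_m) k : tau (u *+ k)%R = tau u ^+ k.
Proof.
elim: k => [|k IHk]; first by rewrite mulr0n; exact: (morph1 tau).
by rewrite mulrSr expgSr -IHk -(morphM tau) ?inE.
Qed.

Lemma character_expg tau (u : 'Z_m) : tau u = tau c1 ^+ u.
Proof. by rewrite -character_mulrn natr_Zp. Qed.

Lemma im_character tau : tau @* setT = <[tau c1]>.
Proof.
apply/setP=> z; apply/morphimP/cycleP => [[u _ _ ->]|[i ->]].
  by exists (u : 'Z_m); exact: character_expg.
by exists (c1 *+ i)%R; rewrite ?inE ?character_mulrn.
Qed.

Lemma card_ker_character tau : 1 < m -> (#|'ker tau| * #[tau c1])%N = m.
Proof.
move=> m_gt1; rewrite orderE -im_character card_morphim setIid.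
by rewrite Lagrange ?subsetT // cardsT card_ord Zp_cast.
Qed.

Lemma card_ker_character_dvd tau : prime p -> 1 < m ->
  (#|'ker tau| %| m) && (m %/ #|'ker tau| %| p.-1).
Proof.
move=> p_pr m_gt1; have eq_m := card_ker_character tau m_gt1.
have : #[tau c1] %| p.-1.
  rewrite -totient_prime // -card_units_Zp ?prime_gt0 //.
  by rewrite order_dvdG ?inE.
move: eq_m (cardG_gt0 ('ker tau)%G) => /=.
move: #|_| #[_] => k d <- k_gt0 d_p.
by rewrite dvdn_mulr // mulKn.
Qed.

(** The two images are the same subgroup of the cyclic group of units, so tau2
    is tau1 followed by a power map j of this image; after [coprime_lift] the
    exponent j is coprime to m, and u |-> j u is an automorphism of Z_m. *)
Lemma eq_ker_semidirect_iso (tau1 tau2 : mor) :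
    prime p -> 1 < m -> #|'ker tau1| = #|'ker tau2| ->
  brace_iso (semidirect_brace tau2) (semidirect_brace tau1).
Proof.
move=> p_pr m_gt1 eq_ker.
have eq_ord : #[tau1 c1] = #[tau2 c1].
  apply/eqP; rewrite -(eqn_pmul2l (cardG_gt0 ('ker tau1)%G)) /=.
  by rewrite card_ker_character // eq_ker card_ker_character.
have [j co_mj def2] : exists2 j, coprime m j & tau2 c1 = tau1 c1 ^+ j.
  have /eqP eq_cyc : <[tau1 c1]> == <[tau2 c1]>.
    rewrite (eq_subG_cyclic (units_Zp_cyclic p_pr)) ?subsetT //.
    by rewrite -!orderE eq_ord.
  have /cycleP[k def2] : tau2 c1 \in <[tau1 c1]> by rewrite eq_cyc cycle_id.
  (* Adding the order makes the exponent positive. *)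
  have co_k : coprime #[tau1 c1] (k + #[tau1 c1]).
    rewrite /coprime gcdnDr -/(coprime _ _) -generator_coprime -def2.
    by rewrite /generator eq_cyc.
  have k_gt0 : 0 < k + #[tau1 c1] by rewrite addn_gt0 order_gt0 orbT.
  have [j co_mj eq_jk] := coprime_lift k_gt0 (ltnW m_gt1) co_k; exists j => //.
  by rewrite def2; apply/eqP; rewrite eq_expg_mod_order eq_jk modnDr.
pose f (z : semidirect_brace tau2) : semidirect_brace tau1 :=
  (z.1, (z.2 : 'Z_m) *+ j)%R.
have fD : {morph f : y z / (y + z)%R}.
  by case=> [x u] [y v]; congr (_, _) => /=; exact: mulrnDl.
exists f; split=> //.
  apply: injF_bij => -[x u] [y v] [-> eq_uv]; congr (_, _).
  apply/eqP; rewrite -subr_eq0; apply/eqP.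
  apply: (mulrn_coprime_eq0 co_mj); first exact: mulrn_Zp.
  by rewrite mulrnBl eq_uv subrr.
case=> [x u] [y v]; congr (_, _) => /=; last exact: mulrnDl.
rewrite (character_mulrn tau1 u) (character_expg tau2) def2.
by rewrite (character_expg tau1 u) expgAC.
Qed.

(** Additively an isomorphism is (x, u) |-> (c x, d u); comparing the products
    of (0, u) and (1, 0) gives tau1 u = tau2 (d u). *)
Lemma semidirect_iso_eq_ker (tau1 tau2 : mor) :
    1 < p -> 1 < m -> coprime p m ->
  brace_iso (semidirect_brace tau1) (semidirect_brace tau2) ->
  #|'ker tau1| = #|'ker tau2|.
Proof.
move=> p_gt1 m_gt1 co_pm [f0 [/bij_inj f_inj fD fM]].
pose f : 'Z_p * 'Z_m -> 'Z_p * 'Z_m := f0; rewrite -/f in f_inj fD fM.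
have fE := additive_prodE (f := f) p_gt1 m_gt1 co_pm fD.
set c := (f (1, 0)).1%R in fE; set d := (f (0, 1)).2%R in fE.
have cI : injective (fun x : 'Z_p => c * x)%R.
  move=> x y eq_xy; suff [] : ((x, 0) = (y, 0) :> 'Z_p * 'Z_m)%R by [].
  by apply: f_inj; rewrite !fE /= eq_xy.
have dI : injective (fun u : 'Z_m => d * u)%R.
  move=> u v eq_uv; suff [] : ((0, u) = (0, v) :> 'Z_p * 'Z_m)%R by [].
  by apply: f_inj; rewrite !fE /= eq_uv.
have eq_tau (u : 'Z_m) : tau1 u = tau2 (d * u)%R.
  have : (c * (0 + val (tau1 u) * 1) =
          c * 0 + val (tau2 (d * u)) * (c * 1))%R.
    by have := fM (0, u)%R (1, 0)%R; rewrite !fE; apply: (congr1 fst).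
  rewrite mulr0 !add0r !mulr1 => eq_tau.
  by apply/val_inj/cI; rewrite /= eq_tau mulrC.
rewrite -[RHS](card_preimset _ dI); apply: eq_card => u.
rewrite [RHS]inE.
by apply/(kerP _ (in_setT _))/(kerP _ (in_setT _)); rewrite eq_tau.
Qed.

Lemma character_exists k :
    prime p -> 1 < m -> k %| m -> m %/ k %| p.-1 ->
  exists tau : mor, #|'ker tau| = k.
Proof.
move=> p_pr m_gt1 k_m mk_p.
have [z z_ord] : exists z : {unit 'Z_p}, #[z] = (m %/ k)%N.
  have [g gen_g] := cyclicP (units_Zp_cyclic p_pr).
  have g_ord : #[g] = p.-1.
    by rewrite orderE -gen_g card_units_Zp ?totient_prime // prime_gt0.
  have [q def_q] := dvdnP mk_p; exists (g ^+ q).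
  have q_gt0 : 0 < q.
    by have := order_gt0 g; rewrite g_ord def_q muln_gt0 => /andP[].
  by rewrite orderXdiv g_ord def_q ?dvdn_mulr // mulKn.
have zm : z ^+ m = 1.
  by apply/eqP; rewrite -order_dvdn z_ord -{2}(divnK k_m) dvdn_mulr.
have z_mod i : z ^+ (i %% (Zp_trunc m).+2) = z ^+ i.
  by rewrite (Zp_cast m_gt1) expg_mod.
pose h (u : C) := z ^+ (u : 'Z_m).
have hM : {in [set: C] &, {morph h : u v / u * v}}.
  by move=> u v _ _; rewrite /h -expgD -[RHS]z_mod.
exists (Morphism hM); have := card_ker_character (Morphism hM) m_gt1.
have -> : Morphism hM c1 = z by rewrite -[RHS]expg1 -[RHS]z_mod.
have mk_gt0 : 0 < m %/ k by rewrite -z_ord order_gt0.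
rewrite z_ord => eq_m; apply/eqP.
by rewrite -(eqn_pmul2r mk_gt0) eq_m mulnC divnK.
Qed.

(** The abstract semidirect product stores the normal factor on the right and
    acts on it on the right: (a, x) stands for a x.  Hence the action is by the
    inverse of tau, and (x, u) = x u = u (u^-1 x u) is sent to
    (u, tau(u)^-1 x). *)
Lemma semidirect_mul_group (tau : mor) :
  has_semidirect_mul_group p m (semidirect_brace tau).
Proof.
pose to (x : 'Z_p) (u : 'Z_m) : 'Z_p := (val (tau u)^-1%g * x)%R.
have tauD (u v : 'Z_m) : tau (u + v)%R = tau u * tau v.
  by rewrite -(morphM tau) ?inE.
have to_act : is_action [set: 'Z_m] to.
  split=> [u x y|x u v _ _].
    move/(congr1 ( *%R (val (tau u)))).
    by rewrite /to !mulrA -FinRing.val_unitM mulgV !mul1r.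
  rewrite /to mulrA tauD invMg.
  by congr (_ * _)%R; rewrite -[RHS]mulrC.
have to_gact : is_groupAction [set: 'Z_p] (Action to_act).
  move=> u _; rewrite inE; apply/andP; split.
    by apply/subsetP=> x; rewrite inE.
  by apply/morphicP=> x y _ _; rewrite !actpermE /= /to mulrDr.
exists (GroupAction to_gact).
have inX (u : 'Z_m) (x : 'Z_p) :
  (u, x) \in setX [set: 'Z_m]%G [set: 'Z_p]%G by rewrite !inE.
pose h (z : mulgroup (semidirect_brace tau)) :
    sdprod_by (GroupAction to_gact) :=
  SdPair (GroupAction to_gact) (inX z.2 (to z.1 z.2)).
have hM : {in [set: mulgroup (semidirect_brace tau)] &,
            {morph h : z w / z * w}}.
  move=> [x u] [y v] _ _; apply: val_inj.
  suff e : to (x + val (tau u) * y)%R (u + v)%R =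
           (to (to x u) v + to y v)%R.
    by congr (_, _); exact: e.
  rewrite /to tauD invMg FinRing.val_unitM mulrDr -!mulrA; congr (_ + _ * _)%R.
  by rewrite mulrA -FinRing.val_unitM mulVg mul1r.
apply: (isom_isog (Morphism hM)); rewrite ?subxx //; apply/isomP; split.
  apply/injmP=> -[x u] [y v] _ _ /(congr1 val)[<- eq_xy]; congr (_, _).
  exact/(proj1 to_act u)/val_inj.
apply/setP=> w; rewrite inE; apply/morphimP.
case: w => [[u x] w_in]; exists (val (tau u) * x, u)%R; rewrite ?inE //.
apply: val_inj; congr (_, _).
by rewrite /= /to mulrA -FinRing.val_unitM mulVg mul1r.
Qed.
End TrivialBraceCharacters.

(** * Braces with additive group Z_p x Z_12 *)

Section Structure.
Import GRing.Theory.
Local Open Scope ring_scope.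

(** Here u + beta u * v is the multiplication of a brace with additive group
    Z_12, and gamma embeds its multiplicative group in the cyclic group Z_12.
    Commutativity determines beta from b = beta 1, namely
    beta u = 1 + (b - 1) u.  As beta 1 and beta 2 = 2 b - 1 are units, b is 1 or
    7; for b = 7 both 3 and 6 are multiplicative involutions, while a cyclic
    group has at most one. *)
Lemma beta_eq1_of_cyclic_mul (beta gamma : 'Z_12 -> 'Z_12) :
    (forall u, beta u \is a GRing.unit) -> injective gamma ->
    (forall u v, gamma (u + beta u * v) = gamma u + gamma v) ->
  forall u, beta u = 1.
Proof.
move=> beta_unit gamma_inj gammaM.
have betaE u : beta u = 1 + (beta 1 * u - u).
  apply: (addrI u); rewrite [RHS]addrCA [u + (_ - u)]addrC subrK.
  by apply: gamma_inj; rewrite -[X in u + X]mulr1 !gammaM addrC.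
have gamma0 : gamma 0 = 0.
  by apply: (addrI (gamma 0)); rewrite -gammaM mulr0 !addr0.
suff beta1 : beta 1 = 1 by move=> u; rewrite betaE beta1 mul1r subrr addr0.
have beta1_17 : beta 1 = 1 \/ beta 1 = 7%:R.
  have := beta_unit 1; have := beta_unit 2%:R; rewrite betaE.
  case: (beta 1) => b b_lt.
  move: b_lt; do 12 (case: b => [|b]; first by move=> ? //= ? ?;
    first [by left; apply: val_inj | by right; apply: val_inj]).
  by [].
case: beta1_17 => // beta1.
have twice0 (x : 'Z_12) : x + x = 0 -> x = 0 \/ x = 6%:R.
  case: x => x x_lt.
  move: x_lt; do 12 (case: x => [|x]; first by move=> ? //= ?;
    first [by left; apply: val_inj | by right; apply: val_inj]).
  by [].
have gamma6 u : u != 0 -> u + beta u * u = 0 -> gamma u = 6%:R.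
  move=> u_nz uu0; case: (twice0 (gamma u)) => //; first by rewrite -gammaM uu0.
  by rewrite -gamma0 => /gamma_inj /eqP; rewrite (negPf u_nz).
have : gamma 3%:R = gamma 6%:R.
  by rewrite !gamma6 // betaE beta1; apply: val_inj.
by move/gamma_inj.
Qed.

Lemma unit_character (gT : finGroupType) n (c : gT -> 'Z_n) :
    c 1%g = 1 -> (forall a b, c (a * b)%g = c a * c b) ->
  exists chi : {morphism [set: gT] >-> {unit 'Z_n}},
    forall a, val (chi a) = c a.
Proof.
move=> c1 cM.
have c_unit a : c a \is a GRing.unit.
  by apply/unitrPr; exists (c a^-1%g); rewrite -cM mulgV.
pose chi a := FinRing.unit _ (c_unit a).
have chiM : {in [set: gT] &, {morph chi : a b / (a * b)%g}}.
  by move=> a b _ _; apply: val_inj; exact: cM.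
by exists (Morphism chiM).
Qed.

Lemma character_coprime_eq1 (gT : finGroupType) n k
    (chi : {morphism [set: gT] >-> {unit 'Z_n}}) (a : gT) :
  (0 < n)%N -> coprime k (totient n) -> (a ^+ k = 1)%g -> chi a = 1%g.
Proof.
move=> n_gt0 co_kn ak; apply/eqP.
rewrite -order_eq1 -dvdn1 -(eqP co_kn) dvdn_gcd.
rewrite -card_units_Zp // order_dvdG ?inE // andbT order_dvdn.
by rewrite -(morphX chi) ?inE // ak (morph1 chi).
Qed.

Lemma bone0 (B : leftBraceType) : bone = 0 :> B.
Proof.
have := bmulDr (bone : B) 0 0; rewrite !bmul1b !addr0 add0r.
by move/eqP; rewrite eq_sym oppr_eq0 => /eqP.
Qed.

Section Lambda.
Variables (p m : nat) (B : finLeftBraceType) (f : B -> 'Z_p * 'Z_m).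
Hypotheses (p_gt1 : (1 < p)%N) (m_gt1 : (1 < m)%N) (co_pm : coprime p m).
Hypotheses (f_bij : bijective f) (fD : {morph f : x y / x + y}).

(** The characters are the diagonal entries of the additive automorphism
    b |-> a b - a, transported to Z_p x Z_m along f. *)
Lemma lambda_characters :
  exists (alpha : {morphism [set: mulgroup B] >-> {unit 'Z_p}})
         (beta : {morphism [set: mulgroup B] >-> {unit 'Z_m}}),
  forall a b, f (bmul a b) =
    f a + (val (alpha a) * (f b).1, val (beta a) * (f b).2).
Proof.
have [g fK gK] := f_bij.
have fB x y : f (x - y) = f x - f y.
  by apply/eqP; rewrite eq_sym subr_eq -fD subrK.
have gD : {morph g : x y / x + y}.
  by move=> x y; apply: (can_inj fK); rewrite fD !gK.
pose L a z := f (bmul a (g z)) - f a.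
have LD a : {morph L a : z w / z + w}.
  by move=> z w; rewrite /L gD bmulDr fD fB addrA addrAC.
have LE a := additive_prodE p_gt1 m_gt1 co_pm (LD a).
have LM a b z : L (bmul a b) z = L a (L b z).
  have -> : L b z = f (bmul b (g z) - b) by rewrite fB.
  rewrite /L fK -bmulA -[bmul b (g z)](subrK b) bmulDr subrK fD fB.
  by rewrite addrK.
have L1 z : L bone z = z by rewrite /L bmul1b bone0 additive0 // subr0 gK.
have [|a b|alpha alphaE] :=
  @unit_character (mulgroup B) p (fun a => (L a (1, 0)).1).
- by rewrite L1.
- by rewrite (LM a b) LE.
have [|a b|beta betaE] :=
  @unit_character (mulgroup B) m (fun a => (L a (0, 1)).2).
- by rewrite L1.
- by rewrite (LM a b) LE.
by exists alpha, beta => a b; rewrite alphaE betaE -LE /L fK addrC subrK.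
Qed.

Lemma semidirect_mul_proj (to : groupAction [set: 'Z_m] [set: 'Z_p]) :
    [set: mulgroup B] \isog [set: sdprod_by to] ->
  exists2 gamma : B -> 'Z_m,
    {morph gamma : a b / bmul a b >-> a + b} & forall u, exists a, gamma a = u.
Proof.
case/isogP=> phi inj_phi im_phi.
exists (fun a => (pair_of_sd (phi a)).1) => [a b | u].
  by rewrite -[bmul a b]/((a : mulgroup B) * b)%g (morphM phi) ?inE.
have u_in : (u, 0 : 'Z_p) \in setX [set: 'Z_m]%G [set: 'Z_p]%G by rewrite !inE.
have : SdPair to u_in \in (phi @* setT)%g by rewrite im_phi inE.
by case/morphimP=> a _ _ def_a; exists a; rewrite -def_a.
Qed.

(** The product of (x, 0) and (y, 0) has second coordinate 0 + beta * 0 = 0, so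
    the factor Z_p is a multiplicative subgroup; its order is p. *)
Lemma expg_Zp_factor (alpha : {morphism [set: mulgroup B] >-> {unit 'Z_p}})
         (beta : {morphism [set: mulgroup B] >-> {unit 'Z_m}}) :
    (forall a b, f (bmul a b) =
       f a + (val (alpha a) * (f b).1, val (beta a) * (f b).2)) ->
  forall a : mulgroup B, (f a).2 = 0 -> (a ^+ p = 1)%g.
Proof.
move=> fM a a_P; pose P := [set b : mulgroup B | (f b).2 == 0].
have gP : group_set P.
  apply/group_setP; split=> [|b c].
    by rewrite inE -[1%g]/(bone : B) bone0 (additive0 fD).
  rewrite !inE => /eqP b_P /eqP c_P.
  by rewrite -[(b * c)%g]/(bmul (b : B) c) fM /= b_P c_P mulr0 addr0.
have [g fK gK] := f_bij.
have cardP : #|P| = p.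
  have h_inj : injective (fun x : 'Z_p => g (x, 0)).
    by move=> x y /(can_inj gK)[].
  rewrite -[RHS](Zp_cast p_gt1) -[RHS]card_ord -cardsT -(card_imset _ h_inj).
  apply: eq_card => b; rewrite inE; apply/eqP/imsetP => [b_P | [x _ ->]].
    by exists (f b).1; rewrite ?inE // -b_P -surjective_pairing fK.
  by rewrite gK.
by rewrite -{1}cardP; apply: (expg_cardG (G := Group gP)); rewrite inE a_P.
Qed.
End Lambda.

(** With x0 and u0 the embeddings of the two factors, every element is a product
    x0 x * u0 u, and gamma is the projection of the multiplicative group onto
    its quotient Z_12.  The restriction of gamma to u0 identifies this quotient
    with Z_12 carrying the product u + beta u * v. *)
Lemma brace_Zp_Z12_semidirect p (B : finLeftBraceType) :
    prime p -> (7 <= p)%N -> brace_Zp_Z12 p B ->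
  exists tau : {morphism [set: mulgroup (trivial_brace 'Z_12)] >-> {unit 'Z_p}},
    brace_iso B (semidirect_brace tau).
Proof.
move=> p_pr p_ge7 [[f [f_bij fD]] [to isoB]].
have p_gt1 := prime_gt1 p_pr; have p_gt0 := prime_gt0 p_pr.
have co_p12 := coprime_prime_12 p_pr p_ge7.
have [alpha [beta fM]] := lambda_characters (m := 12) p_gt1 isT co_p12 f_bij fD.
have [gamma gammaM gamma_surj] := semidirect_mul_proj isoB.
have expP := expg_Zp_factor (m := 12) p_gt1 f_bij fD fM.
have [g fK gK] := f_bij.
pose x0 (x : 'Z_p) := g (x, 0); pose u0 (u : 'Z_12) := g (0, u).
have x0p x : ((x0 x : mulgroup B) ^+ p = 1)%g by apply: expP; rewrite gK.
have alphaM a b : alpha (bmul a b) = (alpha a * alpha b)%g.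
  exact: (morphM alpha (in_setT _) (in_setT _)).
have betaM a b : beta (bmul a b) = (beta a * beta b)%g.
  exact: (morphM beta (in_setT _) (in_setT _)).
have alphaP x : alpha (x0 x) = 1%g.
  apply: (@character_coprime_eq1 _ p p alpha _ p_gt0 _ (x0p x)).
  exact: coprime_totient_prime.
have betaP x : beta (x0 x) = 1%g.
  apply: (@character_coprime_eq1 _ 12 p beta _ _ _ (x0p x)) => //.
  exact: coprime_prime_ge7.
have gamma1 : gamma bone = 0.
  by apply: (addrI (gamma bone)); rewrite -gammaM bmul1b addr0.
have gammaP x : gamma (x0 x) = 0.
  apply: (mulrn_coprime_eq0 co_p12); last exact: mulrn_Zp.
  rewrite -gamma1 -[bone]/(1 : mulgroup B)%g -(x0p x).
  elim: (p) => [|k IHk]; first by rewrite mulr0n -gamma1.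
  by rewrite mulrSr IHk -gammaM expgSr.
(* The characters and gamma are trivial on the factor Z_p, so they factor
   through the second coordinate. *)
have split_xu a : a = bmul (x0 (f a).1) (u0 (f a).2).
  apply: (can_inj fK); rewrite fM !gK alphaP betaP /= !mul1r.
  by rewrite [LHS]surjective_pairing; congr (_, _); rewrite /= ?addr0 ?add0r.
have alphaE a : alpha a = alpha (u0 (f a).2).
  by rewrite {1}(split_xu a) alphaM alphaP mul1g.
have betaE a : beta a = beta (u0 (f a).2).
  by rewrite {1}(split_xu a) betaM betaP mul1g.
have gammaE a : gamma a = gamma (u0 (f a).2).
  by rewrite {1}(split_xu a) gammaM gammaP add0r.
have u0M u v : bmul (u0 u) (u0 v) = u0 (u + val (beta (u0 u)) * v).
  apply: (can_inj fK); rewrite fM !gK /= mulr0.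
  by congr (_, _); rewrite /= addr0.
(* A surjective endomap of a finite set is injective. *)
have gamma_inj : injective (gamma \o u0).
  have [v|h hK] := fin_all_exists (P := fun v u => gamma (u0 u) = v).
    by have [a <-] := gamma_surj v; exists (f a).2; rewrite -gammaE.
  exact: can_inj (canF_sym hK).
have beta1 u : beta (u0 u) = 1%g.
  apply: val_inj.
  apply: (@beta_eq1_of_cyclic_mul (fun v => val (beta (u0 v)))
            (gamma \o u0)) => //.
    by move=> v; exact: valP (beta (u0 v)).
  by move=> v w; rewrite /= -u0M gammaM.
pose t (u : mulgroup (trivial_brace 'Z_12)) := alpha (u0 u).
have tM : {in [set: mulgroup (trivial_brace 'Z_12)] &,
            {morph t : u v / (u * v)%g}}.
  by move=> u v _ _; rewrite /t -alphaM u0M beta1 mul1r.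
exists (Morphism tM), f; split => // a b.
rewrite fM alphaE betaE beta1.
by congr (_, _); rewrite /= mul1r.
Qed.
End Structure.

(** * Classification by the order of the kernel *)

Lemma brace_iso_trans (A B C : leftBraceType) :
  brace_iso A B -> brace_iso B C -> brace_iso A C.
Proof.
move=> [f [f_bij fD fM]] [g [g_bij gD gM]]; exists (g \o f); split.
- exact: bij_comp.
- by move=> x y; rewrite /= fD gD.
by move=> x y; rewrite /= fM gM.
Qed.

Lemma full_kernel_direct_product p (B : finLeftBraceType) :
  has_kernel_of_order p B 12 -> is_direct_product p B.
Proof.
case=> B' [tau [cardB' isoB ker_tau]]; exists B'; split=> //.
apply: (brace_iso_trans isoB); exists id; split=> //.
  exact: (Bijective (g := id)).
have tau1 (u : mulgroup B') : tau u = 1%g.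
  apply/(kerP _ (in_setT _)).
  suff -> : ('ker tau)%g = [set: mulgroup B'] by rewrite inE.
  by apply/eqP; rewrite eqEcard subsetT ker_tau cardsT cardB'.
by case=> [x u] [y v]; congr (_, _); rewrite /= tau1 GRing.mul1r.
Qed.

(** Only the residue r of p - 1 modulo 12 matters, since the indices 12 / k
    divide 12.  The order of the list s is free and fixes the numbering of the
    braces. *)
Lemma classification_by_kernel p r (s : seq nat) :
    prime p -> 7 <= p -> p = r.+1 %[mod 12] ->
    perm_eq s [seq k <- divisors 12 | 12 %/ k %| r] ->
  exists B : 'I_(size s) -> finLeftBraceType,
    iso_classes (brace_Zp_Z12 p) B
    /\ forall i, has_kernel_of_order p (B i) (nth 0 s i).
Proof.
move=> p_pr p_ge7 p_mod eq_s.
have p_gt1 := prime_gt1 p_pr; have m_gt1 : 1 < 12 by [].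
have co_p12 := coprime_prime_12 p_pr p_ge7.
have uniq_s : uniq s by rewrite (perm_uniq eq_s) filter_uniq ?divisors_uniq.
have mem_s k : (k \in s) = (k %| 12) && (12 %/ k %| p.-1).
  rewrite (perm_mem eq_s) mem_filter -dvdn_divisors // andbC.
  case k12: (k %| 12) => //=.
  have d12 : 12 %/ k %| 12 by rewrite -{2}(divnK k12) dvdn_mulr.
  have : p.-1 = r %[mod 12].
    by apply/eqP; rewrite -(eqn_modDr 1) !addn1 (ltn_predK p_gt1) p_mod.
  move/(congr1 (modn^~ (12 %/ k))); rewrite !modn_dvdm // => eq_mod.
  by rewrite /dvdn eq_mod.
have [i|tau tauE] := fin_all_exists (P := fun (i : 'I_(size s))
    (t : {morphism [set: mulgroup (trivial_brace 'Z_12)] >-> {unit 'Z_p}}) =>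
    #|('ker t)%g| = nth 0 s i).
  by have /[!mem_s]/andP[] := mem_nth 0 (ltn_ord i); exact: character_exists.
exists (fun i => semidirect_brace (tau i)); split; last first.
  move=> i; exists (trivial_brace 'Z_12), (tau i); split=> //.
    by rewrite card_ord.
  exists id; split=> //; exact: (Bijective (g := id)).
split=> [i | i j /(semidirect_iso_eq_ker p_gt1 m_gt1 co_p12) | B0].
- split; last exact: semidirect_mul_group.
  by exists id; split=> //; exact: (Bijective (g := id)).
- by rewrite !tauE => /eqP; rewrite nth_uniq // => /eqP/val_inj.
case/(brace_Zp_Z12_semidirect p_pr p_ge7)=> sigma isoB0.
have : #|('ker sigma)%g| \in s.
  by rewrite mem_s card_ker_character_dvd.
case/(nthP 0)=> i i_lt def_i; exists (Ordinal i_lt).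
apply: (brace_iso_trans isoB0).
by apply: eq_ker_semidirect_iso; rewrite ?tauE.
Qed.

End Theory.

Theorem proposition11 (p : nat) (p_prime : prime p) (p_ge7 : 7 <= p) :
  [/\ p = 11 %[mod 12] ->
        exists B : 'I_2 -> finLeftBraceType,
          [/\ iso_classes (brace_Zp_Z12 p) B,
              is_direct_product p (B 0%R)
            & has_kernel_of_order p (B 1%R) 6],
      p = 5 %[mod 12] ->
        exists B : 'I_3 -> finLeftBraceType,
          [/\ iso_classes (brace_Zp_Z12 p) B,
              is_direct_product p (B 0%R),
              has_kernel_of_order p (B 1%R) 6
            & has_kernel_of_order p (B 2%R) 3],
      p = 7 %[mod 12] ->
        exists B : 'I_4 -> finLeftBraceType,
          [/\ iso_classes (brace_Zp_Z12 p) B,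
              is_direct_product p (B 0%R),
              has_kernel_of_order p (B 1%R) 6,
              has_kernel_of_order p (B 2%R) 2
            & has_kernel_of_order p (B 3%R) 4]
    & p = 1 %[mod 12] ->
        exists B : 'I_6 -> finLeftBraceType,
          [/\ iso_classes (brace_Zp_Z12 p) B,
              is_direct_product p (B 0%R),
              has_kernel_of_order p (B 1%R) 6
            & [/\ has_kernel_of_order p (B 2%R) 4,
                  has_kernel_of_order p (B 3%R) 3,
                  has_kernel_of_order p (B 4%R) 2
                & has_kernel_of_order p (B 5%R) 1]]].
Proof.
split=> p_mod.
- have [B [isoB kerB]] := classification_by_kernel
    (r := 10) (s := [:: 12; 6]) p_prime p_ge7 p_mod isT.
  have dirB := full_kernel_direct_product (kerB 0%R).
  by exists B; split; [| | exact: (kerB 1%R)].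
- have [B [isoB kerB]] := classification_by_kernel
    (r := 4) (s := [:: 12; 6; 3]) p_prime p_ge7 p_mod isT.
  have dirB := full_kernel_direct_product (kerB 0%R).
  by exists B; split; [| | exact: (kerB 1%R) | exact: (kerB 2%R)].
- have [B [isoB kerB]] := classification_by_kernel
    (r := 6) (s := [:: 12; 6; 2; 4]) p_prime p_ge7 p_mod isT.
  have dirB := full_kernel_direct_product (kerB 0%R).
  by exists B; split; [| | exact: (kerB 1%R) | exact: (kerB 2%R)
                      | exact: (kerB 3%R)].
have [B [isoB kerB]] := classification_by_kernel
  (r := 0) (s := [:: 12; 6; 4; 3; 2; 1]) p_prime p_ge7 p_mod isT.
have dirB := full_kernel_direct_product (kerB 0%R).
exists B; split; [done | done | exact: (kerB 1%R) | split].
- exact: (kerB 2%R).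
- exact: (kerB 3%R).
- exact: (kerB 4%R).
exact: (kerB 5%R).
Qed.
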